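(* Let $M$ be a compact metric space and let $f=(f_i)_{i\in\mathbb{Z}}$ be a non-autonomous dynamical system on $\mathbf{M}=\coprod_{i\in\mathbb{Z}}M\times\{i\}$. Then for all $i,j\in\mathbb{Z}$ we have $\mathbf{H}_i(f)=\mathbf{H}_j(f)$.
   Context: Let $(M,d)$ be a compact metric space. For $i\in\mathbb{Z}$ put $M_i=M\times\{i\}$, and let $\mathbf{M}=\coprod_{i\in\mathbb{Z}}M_i$ with the metric $\mathbf{d}(x,y)=\min\{1,d(x,y)\}$ if $x,y$ lie in the same $M_i$ and $\mathbf{d}(x,y)=1$ otherwise. A non-autonomous dynamical system on $\mathbf{M}$ is a sequence $f=(f_i)_{i\in\mathbb{Z}}$ of homeomorphisms $f_i:M_i\to M_{i+1}$. Put $f_i^0=\mathrm{id}_{M_i}$ and $f_i^n=f_{i+n-1}\circ\cdots\circ f_i:M_i\to M_{i+n}$ for $n>0$. A compact set $K\subseteq M_i$ is an $(n,\varepsilon)$-span of $M_i$ with respect to $f$ if for each $x\in M_i$ there is $y\in K$ with $\max_{0\le j<n}\mathbf{d}(f_i^j(x),f_i^j(y))<\varepsilon$. Let $r[n,i](\varepsilon,f)$ be the smallest cardinality of an $(n,\varepsilon)$-span of $M_i$, $r[i](\varepsilon,f)=\limsup_{n\to+\infty}\frac1n\log r[n,i](\varepsilon,f)$, and $\mathbf{H}_i(f)=\lim_{\varepsilon\to0}r[i](\varepsilon,f)\in[0,+\infty]$. *)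

(* Defs.v *)
From HB Require Import structures.
From mathcomp Require Import all_boot all_order all_algebra.
From mathcomp Require Import all_classical all_reals all_analysis.
From mathcomp Require Import lra.

Set Implicit Arguments.
Unset Strict Implicit.
Unset Printing Implicit Defensive.

Import Order.TTheory GRing.Theory Num.Theory.
Import numFieldTopology.Exports numFieldNormedType.Exports.

Local Open Scope classical_set_scope.
Local Open Scope ring_scope.

(* The disjoint union of the M x {i}, a point of M x {i} being a pair (p, i). *)
Definition coprodZ (R : realType) (M : metricType R) : Type := (M * int)%type.

Section coprodZ_metric.
Context {R : realType} {M : metricType R}.

HB.instance Definition _ := Choice.on (coprodZ M).

Definition bdist (x y : coprodZ M) : R :=
  if x.2 == y.2 then Num.min 1 (mdist x.1 y.1) else 1.

Lemma bdistxx x : bdist x x = 0.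
Proof. by rewrite /bdist eqxx mdistxx; apply/min_idPr. Qed.

Lemma bdist_positivity x y : bdist x y = 0 -> x = y.
Proof.
case: x y => [p i] [q j]; rewrite /bdist /=.
case: eqP => [->|_ /eqP]; last by rewrite oner_eq0.
rewrite /Num.min; case: ltP => _; first by move=> /eqP; rewrite oner_eq0.
by move=> /mdist_positivity ->.
Qed.

Lemma bdist_sym x y : bdist x y = bdist y x.
Proof. by rewrite /bdist eq_sym metric_sym. Qed.

Lemma bdist_triangle y x z : bdist x z <= bdist x y + bdist y z.
Proof.
case: x y z => [p i] [q j] [r k]; rewrite /bdist /=.
have pqr := metric_triangle p q r.
have pq := @mdist_ge0 _ _ p q; have qr := @mdist_ge0 _ _ q r.
have minE (a : R) : Num.min 1 a = if 1 < a then 1 else a by [].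
have [->|ij] := eqVneq i j; last first.
  case: (eqVneq j k) => [jk|_]; last case: (eqVneq i k) => _.
  - by rewrite -jk (negbTE ij) minE; case: ifP => _; lra.
  - by rewrite minE; case: ltP => ?; lra.
  - by lra.
case: (eqVneq j k) => _; last by rewrite minE; case: ifP => _; lra.
rewrite !minE; case: (ltP 1 (mdist p r)) => ?; case: (ltP 1 (mdist p q)) => ?;
  by case: (ltP 1 (mdist q r)) => ?; lra.
Qed.

HB.instance Definition _ := isMetric.Build R (coprodZ M)
  bdistxx bdist_positivity bdist_sym bdist_triangle.

End coprodZ_metric.

Definition slice {R : realType} (M : metricType R) (i : int) :
    set (coprodZ M) :=
  [set x | x.2 = i].
Arguments slice {R} M i.

Definition homeomorphism_on (T : topologicalType) (A B : set T) (f : T -> T) :=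
  [/\ set_bij A B f, {within A, continuous f} &
      exists g : T -> T, [/\ set_fun B A g, {in A, cancel f g},
        {in B, cancel g f} & {within B, continuous g}]].

Section entropy.
Context {R : realType} {M : metricType R}.
Implicit Types (f : int -> coprodZ M -> coprodZ M) (i : int) (n : nat) (e : R).

(* Each f i is a total function on the disjoint union; only its values on
   slice M i are constrained, and only those are used below. *)
Definition nonautonomous_system f :=
  forall i, homeomorphism_on (slice M i) (slice M (i + 1)) (f i).

Fixpoint iterate f i n : coprodZ M -> coprodZ M :=
  if n is m.+1 then f (i + m%:Z) \o iterate f i m else id.

Definition is_span f i n e (K : set (coprodZ M)) :=
  [/\ compact K, K `<=` slice M i &
      forall x, slice M i x -> exists2 y, K y &
        \big[Num.max/0]_(j < n) mdist (iterate f i j x) (iterate f i j y) < e].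

(* The infimum over the cardinalities of finite spans; it is +oo when every
   span is infinite. *)
Definition span_card f i n e : \bar R :=
  ereal_inf [set (k%:R)%:E | k in
    [set k : nat | exists2 K, is_span f i n e K & (K #= `I_k)%card]].

Definition entropy_at f i e : \bar R :=
  limn_esup (fun n => ((n%:R^-1)%:E * lne (span_card f i n e))%E).

Definition entropy f i : \bar R := lim (entropy_at f i e @[e --> 0^'+]).

End entropy.

(* Main.v *)
(* It is enough to compare i and i + 1.  Pushing a span of M_i forward by f_i
   gives r[n, i+1](e) <= r[n+1, i](e), and the index shift n -> n+1 is invisible
   to the exponential growth rate.  Conversely f_i^-1 is uniformly continuous on
   the compact slice M_(i+1), so for d small it pulls (n, d)-spans of M_(i+1)
   back to (n, e)-spans of M_i and r[n, i](e) <= r[n, i+1](d).  Letting e tend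
   to 0 equates the two entropies. *)
Require Import Defs.
From HB Require Import structures.
From mathcomp Require Import all_boot all_order all_algebra.
From mathcomp Require Import all_classical all_reals all_analysis.
From mathcomp Require Import lra.
Import Order.TTheory GRing.Theory Num.Theory.
Import numFieldTopology.Exports numFieldNormedType.Exports.
Local Open Scope classical_set_scope.
Local Open Scope ring_scope.

(** Heine-Cantor relative to a subset, since the inverse of [f i] is only controlled on a slice.
    Compactness enters as the near-covering property, which turns local bounds valid for [d] near 0
    into a uniform one. *)
Lemma compact_within_unif_continuous {R : realType} {X Y : metricType R}
    (A : set X) (g : X -> Y) (e : R) :
  compact A -> {within A, continuous g} -> 0 < e ->
  \forall d \near 0^'+, forall x, A x -> forall y, A y ->
    mdist x y < d -> mdist (g x) (g y) < e.
Proof.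
move=> /compact_near_coveringP/near_covering_withinP cA cg e0.
have e20 : 0 < e / 2 by rewrite divr_gt0.
have loc x : A x -> exists2 h, 0 < h & forall y, A y -> mdist x y < h ->
    mdist (g x) (g y) < e / 2.
  move=> Ax; move/subspace_continuousP: cg => /(_ x Ax).
  move/metricType_numDomainType.cvgrPdist_lt => /(_ _ e20).
  move=> /metricType_numDomainType.nbhs_mdistP[h h0 hP].
  by exists h => // y Ay xy; exact: hP.
(* With radius [h / 2], both [x'] and [y] lie within [h] of the centre [x]; the triangle inequality
   through [g x] then gives [e / 2 + e / 2]. *)
have cover x : A x -> \forall x' \near x & d \near 0^'+, A x' ->
    forall y, A y -> mdist x' y < d -> mdist (g x') (g y) < e.
  move=> Ax; have [h h0 hP] := loc x Ax.
  have h20 : 0 < h / 2 by rewrite divr_gt0.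
  exists ([set x' | mdist x x' < h / 2], [set d | d < h / 2]) => /=.
    split; last exact: nbhs_right_lt.
    by apply/metricType_numDomainType.nbhs_mdistP; exists (h / 2).
  move=> [x' d] /= [xx' dh] Ax' y Ay x'y.
  have xy := metric_triangle x x' y.
  have gxy := metric_triangle (g x') (g x) (g y).
  have gx' : mdist (g x) (g x') < e / 2 by apply: hP => //; lra.
  have gy : mdist (g x) (g y) < e / 2 by apply: hP => //; lra.
  by rewrite metric_sym in gx'; lra.
exact: (cA R 0^'+ (fun d x => forall y, A y -> mdist x y < d ->
  mdist (g x) (g y) < e) _ cover).
Qed.

Lemma lee_limn_esup {R : realType} (u v : (\bar R)^nat) :
  (forall n, u n <= v n)%E -> (limn_esup u <= limn_esup v)%E.
Proof.
move=> uv; apply: le_ereal_inf_tmp => _ [V oV <-].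
apply: le_trans (ereal_inf_lbound _) _; first by exists V.
apply: ge_ereal_sup => _ [n Vn <-]; apply: le_trans (uv n) _.
by apply: ereal_sup_ubound; exists n.
Qed.

Lemma limn_esup_ge0 {R : realType} (u : (\bar R)^nat) :
  (forall n, 0 <= u n)%E -> (0 <= limn_esup u)%E.
Proof. by move=> u0; apply: limf_esup_ge0 => // -[n _ /(_ n (leqnn n))]. Qed.

(** Compares tails of [u] with tails of [v] started one index later; the factor [r] leaves room for
    replacing the weight [1/n] by [1/(n+1)]. *)
Lemma limn_esup_shift_le {R : realType} (r : R) (u v : (\bar R)^nat) :
  0 < r -> (\forall n \near \oo, r%:E * u n <= v n.+1)%E ->
  (r%:E * limn_esup u <= limn_esup v)%E.
Proof.
move=> r0 [N _ uv]; apply: le_ereal_inf_tmp => _ [V [N' _ N'V] <-].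
rewrite -lee_pdivlMl//.
(* Beyond [maxn N N'] the hypothesis applies at [n] and [n.+1] lies in [V]. *)
apply: (@le_trans _ _ (ereal_sup (u @` [set n | (maxn N N' <= n)%N]))).
  by apply: ereal_inf_lbound; exists [set n | (maxn N N' <= n)%N] => //;
    exists (maxn N N').
apply: ge_ereal_sup => _ [n /= + <-]; rewrite geq_max => /andP[Nn N'n].
rewrite lee_pdivlMl//; apply: le_trans (uv n Nn) _.
by apply: ereal_sup_ubound; exists n.+1 => //; apply: N'V => /=; exact: leqW.
Qed.

Lemma slice_compact {R : realType} {M : metricType R} i :
  compact [set: M] -> compact (slice M i).
Proof.
move=> cM; have -> : slice M i = (fun p => (p, i) : coprodZ M) @` [set: M].
  by apply/seteqP; split=> [[p k] <-|_ [p _ <-]//]; exists p.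
apply: continuous_compact cM; apply: continuous_subspaceT => p.
apply/metricType_numDomainType.cvgrPdist_lt => e e0.
apply/metricType_numDomainType.nbhs_mdistP; exists e => //= q pq.
rewrite /mdist/= /bdist/= eqxx; apply: le_lt_trans pq.
by rewrite ge_min lexx orbT.
Qed.

Section spans.
Context {R : realType} {M : metricType R} {f : int -> coprodZ M -> coprodZ M}.
Implicit Types (i j : int) (n m k : nat) (e d : R) (K : set (coprodZ M)).

(** [iterate] adds maps at the end; peeling off the first one instead relates orbits from [i] to
    orbits from [i + 1]. *)
Lemma iterateS i n : iterate f i n.+1 = iterate f (i + 1) n \o f i.
Proof.
elim: n => [|n IH]; first by rewrite /= addr0.
by rewrite [LHS]/= -/(iterate f i n.+1) IH /= -addrA -intS.
Qed.

(** Finite sets are compact, and [0 < e] takes care of the default value 0 of the maximum, including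
    the case [n = 0]. *)
Lemma is_spanP {i n e K} : 0 < e -> finite_set K ->
  is_span f i n e K <-> K `<=` slice M i /\
    forall x, slice M i x -> exists2 y, K y & forall k, (k < n)%N ->
      mdist (iterate f i k x) (iterate f i k y) < e.
Proof.
move=> e0 fK; split=> [[_ KM KP]|[KM KP]]; split=> //.
- move=> x /KP[y Ky /bigmax_ltP[_ xy]]; exists y => // k kn.
  exact: (xy (Ordinal kn)).
- exact: finite_compact.
- move=> x /KP[y Ky xy]; exists y => //.
  by apply/bigmax_ltP; split=> // k _; exact: xy.
Qed.

Lemma span_card_le {h : coprodZ M -> coprodZ M} {i j n m e d} :
  (forall K, finite_set K -> is_span f i n e K -> is_span f j m d (h @` K)) ->
  (span_card f j m d <= span_card f i n e)%E.
Proof.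
move=> hP; apply: le_ereal_inf_tmp => _ [k [K KP Kk] <-].
have fK : finite_set K by apply/finite_setP; exists k.
have /finite_setP[l hl] : finite_set (h @` K) by exact: finite_image.
apply: (@le_trans _ _ (l%:R)%:E).
  by apply: ereal_inf_lbound; exists l => //; exists (h @` K) => //; exact: hP.
rewrite lee_fin ler_nat -card_le_II -(card_le_eql hl) -(card_le_eqr Kk).
exact: card_image_le.
Qed.

Lemma span_card_ge0 i n e : (0 <= span_card f i n e)%E.
Proof. by apply: le_ereal_inf_tmp => _ [k _ <-]; rewrite lee_fin. Qed.

(** A point of [M] makes every slice, hence every span, nonempty; this keeps logarithms
    nonnegative. *)
Lemma span_card_ge1 (p : M) i n e : (1 <= span_card f i n e)%E.
Proof.
apply: le_ereal_inf_tmp => _ [k [K [_ _ KP] Kk] <-].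
rewrite lee_fin ler1n lt0n; apply/negP => /eqP k0.
have [y Ky _] := KP ((p, i) : coprodZ M) erefl.
by move: Kk; rewrite k0 II0 card_eq0 => /eqP K0; rewrite K0 in Ky.
Qed.

Lemma le_entropy_at i j e d :
  (forall n, span_card f i n e <= span_card f j n d)%E ->
  (entropy_at f i e <= entropy_at f j d)%E.
Proof.
move=> le_ij; apply: lee_limn_esup => n; apply: lee_wpmul2l.
  by rewrite lee_fin invr_ge0.
by rewrite lee_lne ?le_ij// in_itv/= leey span_card_ge0.
Qed.

Lemma span_card_anti i n e d : 0 < e -> e <= d ->
  (span_card f i n d <= span_card f i n e)%E.
Proof.
move=> e0 ed; have d0 := lt_le_trans e0 ed.
apply: (@span_card_le id) => K fK /(is_spanP e0 fK)[KM KP].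
rewrite image_id; apply/is_spanP => //; split=> // x /KP[y Ky xy].
by exists y => // k kn; apply: lt_le_trans (xy k kn) ed.
Qed.

(** Shrinking [e] increases [entropy_at], so the limit at 0 is a supremum, and comparing entropies
    needs only one suitable [d] for each [e]. *)
Lemma entropyE i :
  entropy f i = ereal_sup (entropy_at f i @` `]0, +oo[%classic).
Proof.
apply/cvg_lim => //; apply: nonincreasing_at_right_cvge => // e d.
rewrite !in_itv/= !andbT => e0 d0 ed.
by apply: le_entropy_at => n; exact: span_card_anti.
Qed.

Hypothesis f_nads : nonautonomous_system f.

Lemma span_card_forward i n e : 0 < e ->
  (span_card f (i + 1) n e <= span_card f i n.+1 e)%E.
Proof.
move=> e0; have [[fM _ fsurj] _ _] := f_nads i.
apply: (@span_card_le (f i)) => K fK /(is_spanP e0 fK)[KM KP].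
apply/is_spanP => //; first exact: finite_image.
split=> [_ [x /KM Mx <-]|_ /fsurj[x /KP[y Ky xy] <-]]; first exact: fM.
exists (f i y); first by exists y.
by move=> k kn; have := xy k.+1 kn; rewrite !iterateS.
Qed.

Lemma span_card_backward i e : compact [set: M] -> 0 < e ->
  exists2 d, 0 < d &
    forall n, (span_card f i n e <= span_card f (i + 1) n d)%E.
Proof.
move=> cM e0; have [[fM _ _] _ [g [gM fK gK cg]]] := f_nads i.
have cM1 := slice_compact (i + 1) cM.
have unif := compact_within_unif_continuous _ _ e cM1 cg e0.
(* Uniform continuity of [g] serves time 0 only. At time [k + 1] the orbit of [g y] is that of [y]
   at time [k], where [d <= e] suffices. Thus [d] does not depend on [n]. *)
have [d [[gd d0] de]] : exists d, ((forall x, slice M (i + 1) x ->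
    forall y, slice M (i + 1) y -> mdist x y < d -> mdist (g x) (g y) < e) /\
    0 < d) /\ d <= e.
  apply: (@filter_ex _ (0^'+)); near=> d.
  split; [split; near: d; [exact: unif|exact: nbhs_right_gt]|].
  by near: d; exact: nbhs_right_le.
exists d => // n; apply: (@span_card_le g) => K finK.
move=> /(is_spanP d0 finK)[KM KP].
apply/is_spanP => //; first exact: finite_image.
split=> [_ [y /KM My <-]|x Mx]; first exact: gM.
have [y Ky xy] := KP _ (fM _ Mx).
exists (g y); first by exists y.
move=> [|k] kn; last first.
  rewrite !iterateS /= gK ?inE; last exact: KM.
  by apply: lt_le_trans de; apply: xy; exact: ltnW.
rewrite /= -[x]fK ?inE//.
exact: gd (fM _ Mx) _ (KM _ Ky) (xy _ kn).
Unshelve. all: by end_near. Qed.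

Lemma entropy_at_forward i e : 0 < e ->
  (entropy_at f (i + 1) e <= entropy_at f i e)%E.
Proof.
move=> e0; have [[p]|M0] := pselect (inhabited M); last first.
  (* For empty [M] the lower bound 1 on span cardinalities fails, but every span condition holds
     vacuously. *)
  apply: le_entropy_at => n; apply: (@span_card_le id) => K fK _.
  have K0 (x : coprodZ M) : False by case: x => p; case: M0.
  by rewrite image_id; apply/is_spanP => //; split=> x; case: (K0 x).
have lne_span_ge0 j n : (0 <= lne (span_card f j n e))%E.
  by rewrite lne_ge0 span_card_ge1.
(* For a nonnegative left side it suffices to prove the bound after scaling by each [r] in []0,
   1[]. *)
apply/lee_mul01Pr => [|r /andP[r0 r1]].
  by apply: limn_esup_ge0 => n; rewrite mule_ge0// lee_fin invr_ge0.
apply: limn_esup_shift_le => //; near=> n.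
rewrite muleA; apply: lee_pmul => //.
- by rewrite -EFinM lee_fin mulr_ge0 ?invr_ge0// ltW.
- rewrite -EFinM lee_fin ler_pdivrMr; last first.
    by rewrite ltr0n; near: n; exists 1%N.
  rewrite mulrC ler_pdivlMr ?ltr0n//.
  (* The inequality [r / n <= 1 / (n + 1)] amounts to [n >= r / (1 - r)]. *)
  have : r / (1 - r) <= n%:R by near: n; exact: nbhs_infty_ger.
  by rewrite ler_pdivrMr ?subr_gt0// -natr1; lra.
- by rewrite lee_lne ?span_card_forward// in_itv/= leey span_card_ge0.
Unshelve. all: by end_near. Qed.

Lemma entropy_succ i : compact [set: M] -> entropy f (i + 1) = entropy f i.
Proof.
move=> cM; rewrite !entropyE; apply/eqP; rewrite eq_le; apply/andP; split;
    apply: ge_ereal_sup => _ [e /= + <-]; rewrite in_itv/= andbT => e0.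
  apply: le_trans (entropy_at_forward i _ e0) _.
  by apply: ereal_sup_ubound; exists e => //=; rewrite in_itv/= e0.
have [d d0 ed] := span_card_backward i e cM e0.
apply: le_trans (le_entropy_at _ _ _ _ ed) _.
by apply: ereal_sup_ubound; exists d => //=; rewrite in_itv/= d0.
Qed.

End spans.

Theorem corollary5p6 (R : realType) (M : metricType R)
    (M_compact : compact [set: M])
    (f : int -> coprodZ M -> coprodZ M) (f_nads : nonautonomous_system f)
    (i j : int) :
  entropy f i = entropy f j.
Proof.
suff entropy0 k : entropy f k = entropy f 0 by rewrite !entropy0.
elim/int_ind: k => [|n <-|n <-]; first exact: erefl.
  have -> : (n.+1 : int) = n%:Z + 1 by rewrite intS addrC.
  exact: entropy_succ.
(* The downward step is the successor equality at [-(n + 1)], read backwards. *)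
have -> : - n%:Z = - (n.+1)%:Z + 1 by rewrite intS opprD addrAC addNr add0r.
exact/esym/entropy_succ.
Qed.
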